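(* Let $G$ be a compactly generated, totally disconnected, locally compact group that has no compact, open, normal subgroup. If $\mathrm{mv}(G)=3$, then $G$ is not uniscalar.
   Context: A Cayley--Abels graph for $G$ is a connected, locally finite graph on which $G$ acts vertex-transitively by automorphisms such that vertex stabilizers are compact open subgroups of $G$ (such graphs exist for compactly generated totally disconnected locally compact groups). $\mathrm{mv}(G)$ is the smallest degree of a Cayley--Abels graph for $G$. The scale function is $s(g)=\min\{|U:U\cap g^{-1}Ug| : U\text{ a compact open subgroup of }G\}$; $G$ is uniscalar if $s(g)=1$ for all $g\in G$. *)

(* Defs.v *)
From HB Require Import structures.
From mathcomp Require Import all_boot.
From mathcomp Require Import all_classical topology.

Set Implicit Arguments.
Unset Strict Implicit.
Unset Printing Implicit Defensive.

Local Open Scope classical_set_scope.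
Local Open Scope card_scope.
Local Open Scope group_scope.

HB.mixin Record isTopologicalGroup G & Topological G & Group G := {
  mulg_continuous : continuous (fun x : G * G => x.1 * x.2);
  invg_continuous : continuous (fun x : G => x^-1)
}.

#[short(type="topologicalGroupType")]
HB.structure Definition TopologicalGroup :=
  {G of Topological G & Group G & isTopologicalGroup G}.

(* The least element of A; the value is 0 when A is empty. *)
Definition natmin (A : set nat) : nat :=
  xget 0 [set n | A n /\ forall m, A m -> n <= m].

Section Subgroups.
Variable G : groupType.
Implicit Types (U K H A : set G) (g : G).

Definition subgroup H : Prop :=
  [/\ H 1, forall x y, H x -> H y -> H (x * y) & forall x, H x -> H x^-1].

Definition generated_subgroup A : set G :=
  \bigcap_(H in [set H | subgroup H /\ A `<=` H]) H.

(* g^-1 U g *)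
Definition conjugate U g : set G := [set g^-1 * u * g | u in U].

Definition normal_subgroup H : Prop :=
  subgroup H /\ forall g, conjugate H g = H.

Definition left_cosets U K : set (set G) :=
  [set [set u * k | k in K] | u in U].

(* |U : K| = n; never satisfied when the index is infinite. *)
Definition has_index U K (n : nat) : Prop := left_cosets U K #= `I_n.

End Subgroups.

Section TopologicalGroups.
Variable G : topologicalGroupType.
Implicit Types (U K : set G) (g : G).

Definition compactly_generated : Prop :=
  exists2 K : set G, compact K & generated_subgroup K = setT.

Definition tdlc : Prop :=
  [/\ hausdorff_space G, totally_disconnected [set: G] &
      locally_compact [set: G]].

Definition compact_open_subgroup U : Prop :=
  [/\ subgroup U, compact U & open U].

Definition scale g : nat :=
  natmin [set n | exists2 U : set G, compact_open_subgroup U &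
                             has_index U (U `&` conjugate U g) n].

Definition uniscalar : Prop := forall g, scale g = 1%N.

End TopologicalGroups.

Record sgraph := SGraph {
  vertex :> Type;
  adj : rel vertex;
  adj_sym : symmetric adj;
  adj_irr : irreflexive adj
}.

Section Graphs.
Variable X : sgraph.
Implicit Types v w : X.

Definition neighbours v : set X := [set w | adj v w].

Definition connected_graph : Prop :=
  inhabited X /\
  forall v w, exists2 p : seq X, path (@adj X) v p & last v p = w.

Definition locally_finite : Prop := forall v, finite_set (neighbours v).

Definition has_degree (n : nat) : Prop := forall v, neighbours v #= `I_n.

End Graphs.

Section CayleyAbels.
Variable G : topologicalGroupType.

Record graph_action (X : sgraph) := GraphAction {
  act :> G -> X -> X;
  act1 : forall v, act 1 v = v;
  actM : forall g h v, act (g * h) v = act g (act h v);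
  act_adj : forall g v w, adj (act g v) (act g w) = adj v w
}.

Definition vertex_transitive (X : sgraph) (a : graph_action X) : Prop :=
  forall v w, exists g, a g v = w.

Definition stabilizer (X : sgraph) (a : graph_action X) (v : X) : set G :=
  [set g | a g v = v].

Definition cayley_abels_graph (X : sgraph) : Prop :=
  [/\ connected_graph X, locally_finite X &
      exists a : graph_action X, vertex_transitive a /\
        forall v, compact_open_subgroup (stabilizer a v)].

Definition mv : nat :=
  natmin [set n | exists2 X, cayley_abels_graph X & has_degree X n].

End CayleyAbels.

(* Main.v *)
From HB Require Import structures.
Require Import Defs.
From mathcomp Require Import all_boot.
From mathcomp Require Import finmap.
From mathcomp Require Import all_classical topology.

(** Let [X] be a cubic Cayley-Abels graph of a uniscalar group [G].  For every
    [g] there is a compact open subgroup [W] with [g^-1 W g] inside [W], so for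
    a compact open subgroup [U] the number of left cosets of [U] needed to cover
    [g^-n U g^n] is bounded in [n]; in particular [g^-1 U g <= U] forces equality.

    If a vertex stabilizer fixes all neighbours, it is the kernel of the action.
    Otherwise [G] acts transitively on a reversible digraph with out-degree at
    most two: on the arcs of [X] when [G] is arc-transitive, and on the vertices
    [v] of [X], with [r v] the unique neighbour fixed by the stabilizer of [v]
    and [v -> w] for the other neighbours [w] of [r v], when it is not.

    In such a digraph, if [G] is transitive on [n]-arcs but not on [n+1]-arcs,
    then (as in Tutte's argument) the fixator of an [n]-arc fixes every
    out-neighbour of its end, hence equals the fixator of every shifted or
    reversed arc, and so is the kernel of the action.  If [G] is transitive on
    [n]-arcs for all [n], the set of [n]-step descendants of [v] has bounded
    size, so for large [N] the sets of [N]-step descendants form a system of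
    blocks in which each block determines its successor and its reverse; the
    stabilizer of one block fixes them all.  In each case [G] has a compact open
    normal subgroup. *)

Set Implicit Arguments.
Unset Strict Implicit.
Unset Printing Implicit Defensive.

(** * Compact open subgroups and the uniscalar condition *)

Section CompactOpenSubgroups.
Variable G : topologicalGroupType.
Implicit Types (U W H : set G) (g x u : G).
Local Open Scope classical_set_scope.
Local Open Scope group_scope.

Lemma mulg_left_continuous g : continuous (fun x : G => g * x).
Proof.
move=> x; apply: (@continuous_comp _ _ _ (fun y => (g, y)) (fun z : G * G => z.1 * z.2)).
  by apply: cvg_pair; [exact: cvg_cst | exact: cvg_id].
exact: mulg_continuous.
Qed.

Lemma open_lcoset g U : open U -> open [set x | U (g * x)].
Proof. by move=> oU; apply: open_comp => // x _; apply: mulg_left_continuous. Qed.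

Lemma open_subgroup_closed U : subgroup U -> open U -> closed U.
Proof.
case=> U1 UM UV oU; rewrite -[U]setCK; apply: open_closedC.
rewrite openE => x /= nUx; rewrite /interior.
apply: (filterS (P := [set y | U (x^-1 * y)])) => [y /= Uxy Uy|].
  apply: nUx; rewrite -(mulVKg y x) -[x in y^-1 * x]invgK -invgM.
  by apply: UM => //; apply: UV.
by apply: open_nbhs_nbhs; split; [apply: open_lcoset | rewrite /= mulVg].
Qed.

Lemma compact_lcoset g U : compact U -> compact [set x | U (g^-1 * x)].
Proof.
move=> cU; rewrite (_ : mkset _ = (fun x => g * x) @` U).
  apply: continuous_compact => //; apply: continuous_subspaceT.
  exact: mulg_left_continuous.
apply/seteqP; split=> [x /= Ux|_ [x Ux <-] /=]; last by rewrite mulKg.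
by exists (g^-1 * x) => //; rewrite mulVKg.
Qed.

Lemma compact_open_subgroupI U W : compact_open_subgroup U ->
  compact_open_subgroup W -> compact_open_subgroup (U `&` W).
Proof.
case=> sU cU oU [sW cW oW]; split.
- case: sU sW => U1 UM UV [W1 WM WV]; split=> [//|x y [Ux Wx] [Uy Wy]|x [Ux Wx]].
    by split; [apply: UM | apply: WM].
  by split; [apply: UV | apply: WV].
- by apply: compact_closedI => //; apply: open_subgroup_closed.
- exact: openI.
Qed.

(** [H] is open because it contains the open [W], hence closed; being covered by finitely many
    translates of [U], it is compact. *)
Lemma compact_open_subgroup_commensurable U W H (s : seq G) :
    subgroup H -> compact_open_subgroup U -> compact_open_subgroup W ->
    W `<=` H -> (forall h, H h -> exists2 c, c \in s & U (c^-1 * h)) ->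
  compact_open_subgroup H.
Proof.
move=> sH [sU cU oU] [[W1 _ _] _ oW] WH Hs.
have [H1 HM HV] := sH.
have oH : open H.
  rewrite openE => x Hx; rewrite /interior.
  apply: (filterS (P := [set y | W (x^-1 * y)])) => [y /= /WH Hxy|].
    by rewrite -(mulVKg x y); apply: HM.
  by apply: open_nbhs_nbhs; split; [apply: open_lcoset | rewrite /= mulVg].
split=> //.
apply: (@subclosed_compact _ _ (\big[setU/set0]_(c <- s) [set x | U (c^-1 * x)])).
- exact: open_subgroup_closed.
- by apply: bigsetU_compact => c _; apply: compact_lcoset.
move=> h /Hs [c cs Uch]; rewrite -bigcup_seq; exists c => //=.
Qed.

Lemma compact_finite_lcosets (C : set G) W : compact C -> subgroup W -> open W ->
  exists s : seq G, forall x, C x -> exists2 c, c \in s & W (c^-1 * x).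
Proof.
move=> cC [W1 _ _] oW.
pose pG : ptopologicalType := HB.pack (TopologicalGroup.sort G)
  (isPointed.Build (TopologicalGroup.sort G) 1).
have : @compact pG C by [].
rewrite compact_cover.
case/(_ G setT (fun c => [set x | W (c^-1 * x)])).
- by move=> c _; apply: open_lcoset.
- by move=> x _; exists x => //=; rewrite mulVg.
move=> s _ cov; exists (enum_fset s) => x /cov [c /= cs Wc]; by exists c.
Qed.

(** The default value of [natmin] is 0, so a scale of 1 is attained by some [W]; index 1 then says
    that [W] lies in [g^-1 W g]. *)
Lemma uniscalar_conjg_sub g : uniscalar G ->
  exists2 W, compact_open_subgroup W & forall x, W x -> W (x ^ g^-1).
Proof.
move=> /(_ g); rewrite /scale /natmin; case: xgetP => // n ->.
move=> [[W cW iW] _] n1; rewrite n1 in iW.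
have [[W1 WM WV] _ _] := cW.
exists W => // x Wx.
have /card_set_bijP [f [ff finj _]] := iW.
pose K := W `&` conjugate W g.
pose coset (w : G) : set G := [set w * k | k in K].
have Lx : left_cosets W K (coset x) by exists x.
have L1 : left_cosets W K (coset 1) by exists 1.
have e : coset x = coset 1.
  apply: finj; rewrite ?inE //.
  have := ff _ Lx; have := ff _ L1; rewrite /=.
  by case: (f (coset x)) => //; case: (f _).
have K1 : K 1 by split=> //; exists 1 => //; rewrite mulg1 mulVg.
have : coset x x by exists 1 => //; rewrite mulg1.
rewrite e => -[k [_ [w Ww wk]] <-]; rewrite mul1g -wk.
by rewrite -mulgA -conjgE conjgK.
Qed.

Lemma conjg_expg_stable W g n :
  (forall x, W x -> W (x ^ g)) -> forall x, W x -> W (x ^ (g ^+ n)).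
Proof.
move=> Wg x Wx; elim: n => [|n IH]; first by rewrite expg0 conjg1.
by rewrite expgSr conjgM; apply: Wg.
Qed.

(** Conjugation by [g] preserves some compact open [W]. Covering [U] by cosets [c1 W] and [W] by
    cosets [c2 U], the conjugate of [U] by [g^n] is covered by the cosets [(c1 ^ g^n) c2 U], whose
    number does not depend on [n]. *)
Lemma uniscalar_bounded_index U g : uniscalar G -> compact_open_subgroup U ->
  exists K : nat, forall n, exists2 s : seq G, size s <= K &
    forall u, U u -> exists2 c, c \in s & U (c^-1 * u ^ (g ^+ n)).
Proof.
move=> uG cU; have [sU cpU oU] := cU.
have [W [sW cpW oW] Wg] := uniscalar_conjg_sub g^-1 uG.
rewrite invgK in Wg.
have [s1 s1P] := compact_finite_lcosets cpU sW oW.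
have [s2 s2P] := compact_finite_lcosets cpW sU oU.
exists (size s1 * size s2)%N => n.
exists [seq c1 ^ (g ^+ n) * c2 | c1 <- s1, c2 <- s2]; first by rewrite size_allpairs.
move=> u /s1P [c1 c1s Wu].
have := conjg_expg_stable n Wg Wu; rewrite conjMg conjVg => /s2P [c2 c2s Uc].
exists (c1 ^ (g ^+ n) * c2); first exact: allpairs_f.
by rewrite invgM -mulgA.
Qed.

(** A strict inclusion of [g^-1 U g] in [U] would make the groups [g^n U g^-n] strictly increase,
    with unbounded index over [U]. *)
Lemma uniscalar_conjg_eq U g : uniscalar G -> compact_open_subgroup U ->
  (forall u, U u -> U (u ^ g)) -> forall u, U u -> U (u ^ g^-1).
Proof.
move=> uG cU Ug x Ux; apply: contrapT => nUx.
have [[U1 UM UV] _ _] := cU.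
have [K /(_ K.+1) [s sK sP]] := uniscalar_bounded_index g^-1 uG cU.
(* The elements y_j := x ^ (g^-(j+1)), for j <= K, lie in distinct left cosets of U. *)
pose y j := x ^ (g^-1 ^+ j.+1).
have yP j : exists c, j < K.+1 -> c \in s /\ U (c^-1 * y j).
  case: (ltnP j K.+1) => [jK|]; last by exists 1.
  (* [y j] is the conjugate by [g^-(K+1)] of [x ^ g^(K-j)], which lies in [U]; hence the cosets in
     [s] cover it. *)
  have [c cs Uc] := sP _ (conjg_expg_stable (K - j) Ug Ux).
  exists c => _; split=> //; move: Uc.
  rewrite -conjgM (_ : K.+1 = (K - j) + j.+1)%N; last by rewrite addnS subnK.
  by rewrite expgnDr [g^-1 ^+ (K - j)]expVgn mulVKg.
have [c cP] := choice yP.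
have : uniq (map c (iota 0 K.+1)).
  rewrite map_inj_in_uniq ?iota_uniq // => i j.
  rewrite !mem_iota !add0n /= => iK jK.
  wlog ij : i j iK jK / i < j => [H|] cij.
    by case: (ltngtP i j) => // h; [apply: H | apply/esym/H].
  case: nUx; have [_ Ui] := cP _ iK; have [_ Uj] := cP _ jK.
  have Uij : U ((y i)^-1 * y j).
    have cancel (b z t : G) : z^-1 * t = (b^-1 * z)^-1 * (b^-1 * t).
      by rewrite invgM invgK -mulgA mulVKg.
    by rewrite (cancel (c i)) {2}cij; apply: UM => //; apply: UV.
  (* Conjugation by [g^j] turns [y j] into [x ^ g^-1] and [y i] into an element of [U], so that
     [x ^ g^-1] would be in [U]. *)
  have := conjg_expg_stable j Ug Uij.
  rewrite conjMg conjVg -!conjgM.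
  have -> : g^-1 ^+ j.+1 * g ^+ j = g^-1 by rewrite expgS expVgn -mulgA mulVg mulg1.
  have -> : g^-1 ^+ i.+1 * g ^+ j = g ^+ (j - i.+1).
    by rewrite -{1}(subnKC ij) expgnDr expVgn mulKg.
  move=> Uxx; rewrite -(mulVKg (x ^ g ^+ (j - i.+1)) (x ^ g^-1)).
  by apply: UM => //; apply: conjg_expg_stable.
move=> /uniq_leq_size sub.
have : K.+1 <= size s.
  rewrite -(size_iota 0 K.+1) -(size_map c); apply: sub => _ /mapP [j + ->].
  by rewrite mem_iota add0n => /= jK; have [] := cP _ jK.
by move=> /leq_trans/(_ sK); rewrite ltnn.
Qed.

Lemma normal_subgroupP H : subgroup H ->
  (forall x g, H x -> H (x ^ g)) -> normal_subgroup H.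
Proof.
move=> sH Hn; split=> // g; apply/seteqP; split=> [_ [x Hx <-]|x Hx].
  by rewrite -mulgA; apply: Hn.
by exists (x ^ g^-1); [apply: Hn | rewrite -mulgA -conjgE conjgKV].
Qed.

End CompactOpenSubgroups.

(** * Cardinalities of finite sets *)

Section FiniteCardinality.
Local Open Scope classical_set_scope.

(* Equal to 0 when [A] is infinite. *)
Definition ncard (T : Type) (A : set T) : nat :=
  #|` fset_set (A : set {classic T})|%fset.

Lemma ncard_sub (T : Type) (A B : set T) :
  finite_set B -> A `<=` B -> ncard A <= ncard B.
Proof.
move=> fB AB; have fA : finite_set A by apply: sub_finite_set fB.
by apply: fsubset_leq_card; rewrite -fset_set_sub.
Qed.

Lemma ncard_sub_eq (T : Type) (A B : set T) :
  finite_set B -> A `<=` B -> ncard A = ncard B -> A = B.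
Proof.
move=> fB AB cAB; have fA : finite_set A by apply: sub_finite_set fB.
apply: (@fset_set_inj {classic T}) => //; apply/eqP.
rewrite eqEfcard; apply/andP; split; first by rewrite -fset_set_sub.
by move: cAB; rewrite /ncard => ->.
Qed.

Lemma ncard_image (T S : Type) (f : T -> S) (A : set T) :
  finite_set A -> injective f -> ncard (f @` A) = ncard A.
Proof.
move=> fA fI; rewrite /ncard.
by rewrite (@fset_set_image {classic T} {classic S}) // card_imfset.
Qed.

Lemma ncard_le_size (I : eqType) (T : Type) (f : I -> T) (s : seq I) (A : set T) :
  A `<=` f @` [set` s] -> ncard A <= size s.
Proof.
move=> As; have fA : finite_set A.
  by apply: sub_finite_set As _; apply/finite_image/finite_seq.
rewrite /ncard -(size_map (f : I -> {classic T})); apply: uniq_leq_size => //= x.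
by rewrite in_fset_set // inE => /As [c /= cs <-]; apply: map_f.
Qed.

Lemma nondecreasing_bounded_stable (f : nat -> nat) K :
    (forall n, f n <= f n.+1) -> (forall n, f n <= K) ->
  exists N, forall n, N <= n -> f n = f N.
Proof.
move=> fS fK.
have fm m n : m <= n -> f m <= f n.
  by move=> /subnK <-; elim: (n - m)%N => // k IH; apply: leq_trans IH (fS _).
pose P m := `[< exists n, f n = m >].
have exP : exists m, P m by exists (f 0); apply/asboolP; exists 0.
have boundP m : P m -> m <= K by move=> /asboolP [n <-].
case: (ex_maxnP exP boundP) => _ /asboolP [N <-] maxN.
exists N => n /fm le; apply/eqP; rewrite eqn_leq le andbT.
by apply: maxN; apply/asboolP; exists n.
Qed.

End FiniteCardinality.

(** * Vertex-transitive actions on reversible digraphs *)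

Section ReversibleDigraph.
Local Open Scope classical_set_scope.
Local Open Scope group_scope.

Variables (G : topologicalGroupType) (V : Type) (a : G -> V -> V).
Hypothesis a1 : forall v, a 1 v = v.
Hypothesis aM : forall g h v, a (g * h) v = a g (a h v).
Hypothesis a_trans : forall v w, exists g, a g v = w.
Hypothesis a_stab : forall v, compact_open_subgroup [set g | a g v = v].

Lemma actK g v : a g^-1 (a g v) = v. Proof. by rewrite -aM mulVg a1. Qed.

Lemma actVK g v : a g (a g^-1 v) = v. Proof. by rewrite -aM mulgV a1. Qed.

Lemma act_inj g : injective (a g). Proof. exact: can_inj (actK g). Qed.

Lemma act_conjg x g v : a (x ^ g) v = a g^-1 (a x (a g v)).
Proof. by rewrite conjgE !aM. Qed.

Lemma kernel_compact_open_normal U : compact_open_subgroup U ->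
    (forall g, U g -> forall v, a g v = v) ->
    (forall g, (forall v, a g v = v) -> U g) ->
  exists U : set G, compact_open_subgroup U /\ normal_subgroup U.
Proof.
move=> cU Uker kerU; exists U; split=> //; apply: normal_subgroupP; first by case: cU.
by move=> x g Ux; apply: kerU => v; rewrite act_conjg (Uker x) // actK.
Qed.

Hypothesis uG : uniscalar G.

(** If [h] takes [v] to [w], the stabilizer of [v] is the conjugate by [h] of that of [w], so
    [uniscalar_conjg_eq] applies. *)
Lemma uniscalar_stab_eq v w : (forall g, a g v = v -> a g w = w) ->
  forall g, a g w = w -> a g v = v.
Proof.
move=> vw g gw; have [h hv] := a_trans v w.
have := uniscalar_conjg_eq (g := h) uG (a_stab v).
have stabh u : a u v = v -> a (u ^ h) v = v.
  by move=> /vw uw; rewrite act_conjg hv uw -hv actK.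
move=> /(_ stabh (g ^ h)) /=; rewrite conjgK; apply.
by rewrite act_conjg hv gw -hv actK.
Qed.

Variables (E : V -> V -> Prop) (r : V -> V).
Hypothesis rK : involutive r.
Hypothesis a_r : forall g v, a g (r v) = r (a g v).
Hypothesis aE : forall g v w, E v w -> E (a g v) (a g w).
Hypothesis rE : forall v w, E v w -> E (r w) (r v).
Hypothesis E2 : forall v, exists x y, forall w, E v w <-> w = x \/ w = y.
(** Connectedness as an induction principle. Backward steps are included: by [rE], [x] is reached
    from [y] through [r], the arc from [r y] to [r x], and [r] again. *)
Hypothesis V_connected : forall (v : V) (P : V -> Prop), P v ->
  (forall x, P x -> P (r x)) -> (forall x y, P x -> E x y -> P y) ->
  forall w, P w.

Let arc n (p : nat -> V) := forall i, i < n -> E (p i) (p i.+1).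

Let fixator n (p : nat -> V) : set G :=
  [set g | forall i, i <= n -> a g (p i) = p i].

Let arc_transitive n := forall p q, arc n p -> arc n q ->
  exists g, forall i, i <= n -> a g (p i) = q i.

Lemma arc_extend n p : arc n p ->
  exists2 f, (forall i, E (f i) (f i.+1)) & forall i, i <= n -> f i = p i.
Proof.
move=> pn.
have Eex v : exists w, E v w by have [x [y xy]] := E2 v; exists x; apply/xy; left.
have [succ succP] := choice Eex.
exists (fun i => if i <= n then p i else iter (i - n) succ (p n)) => [i|i ->] //.
case: (ltngtP i n) => [lt|gt|->].
- exact: pn.
- by rewrite subSn ?(ltnW gt) //=.
- by rewrite subSnn.
Qed.

Lemma fixator_compact_open n p : compact_open_subgroup (fixator n p).
Proof.
elim: n => [|n IH].
  rewrite (_ : fixator 0 p = [set g | a g (p 0) = p 0]) //.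
  by apply/seteqP; split=> [g /(_ 0 isT)|g /= gp [|]].
rewrite (_ : fixator n.+1 p = fixator n p `&` [set g | a g (p n.+1) = p n.+1]).
  exact: compact_open_subgroupI.
apply/seteqP; split=> [g gp|g [gp gn] i].
  by split=> [i /leqW /gp|]; last exact: gp.
by rewrite leq_eqVlt => /predU1P [->|/gp].
Qed.

(** * Transitivity on [n]-arcs but not on [n+1]-arcs *)

Section NotHighlyArcTransitive.
Variable n : nat.
Hypothesis n_trans : arc_transitive n.
Hypothesis Sn_ntrans : ~ arc_transitive n.+1.

(** If [g] moved [w], then [w] and [a g w] would be all the out-neighbours of [p n]. Any [n+1]-arc
    could be moved onto [p] followed by one of them, then by [g^-1] if necessary onto [p] followed
    by [w], giving transitivity on [n+1]-arcs. *)
Lemma fixator_out p g w : arc n p -> fixator n p g -> E (p n) w -> a g w = w.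
Proof.
move=> pn gp Ew; apply: contrapT => gw; apply: Sn_ntrans.
have Egw : E (p n) (a g w) by rewrite -{1}(gp n (leqnn n)); apply: aE.
have Eout z : E (p n) z -> z = w \/ z = a g w.
  have [x [y xy]] := E2 (p n).
  move: Ew Egw gw => /xy + /xy; rewrite xy.
  by case=> -> [] -> gw [] ->; tauto.
have toW q : arc n.+1 q ->
    exists2 h, (forall i, i <= n -> a h (q i) = p i) & a h (q n.+1) = w.
  move=> qn; have [h hq] := n_trans (fun i ilt => qn i (leqW ilt)) pn.
  have Eh : E (p n) (a h (q n.+1)) by rewrite -(hq n (leqnn n)); apply/aE/qn.
  have [hw|hw] := Eout _ Eh; first by exists h.
  exists (g^-1 * h) => [i le|]; rewrite aM ?hw ?actK // hq //.
  by rewrite -{1}(gp i le) actK.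
move=> q q' /toW [h hq hqw] /toW [h' hq' hqw']; exists (h'^-1 * h) => i.
rewrite leq_eqVlt aM => /predU1P [->|lt]; first by rewrite hqw -hqw' actK.
by rewrite hq // -hq' // actK.
Qed.

(** One inclusion is [fixator_out]. An element moving [q] to its shift conjugates the two fixators,
    so [uniscalar_conjg_eq] gives equality. *)
Lemma fixator_shift q : arc n.+1 q -> fixator n (fun i => q i.+1) = fixator n q.
Proof.
move=> qn; have qn0 : arc n q by move=> i lt; apply/qn/leqW.
have sub g : fixator n q g -> fixator n (fun i => q i.+1) g.
  move=> gq i; rewrite leq_eqVlt => /predU1P [->|]; last exact: gq.
  by apply: fixator_out qn0 gq (qn n _).
have [h hq] := n_trans qn0 (fun i lt => qn i.+1 lt).
have hconj g : fixator n q (g ^ h) <-> fixator n (fun i => q i.+1) g.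
  split=> gq i le.
    by apply: (act_inj (g := h^-1)); rewrite -hq // -act_conjg gq // actK.
  by rewrite act_conjg hq // gq // -hq // actK.
apply/seteqP; split=> [g /hconj gq|]; last exact: sub.
rewrite -(conjgK h g); apply: uniscalar_conjg_eq gq => //.
  exact: fixator_compact_open.
by move=> u /sub /hconj.
Qed.

Lemma fixator_fixes_all p g v : arc n p -> fixator n p g -> a g v = v.
Proof.
move=> pn gp.
(* The vertices ending an [n]-arc with the same fixator as [p] are shown to be closed under [r] and
   under arcs. *)
pose T z := exists q, [/\ arc n q, fixator n q = fixator n p & q n = z].
suff [q [_ qp <-]] : T v by move: gp; rewrite -qp; apply.
apply: (V_connected (v := p n)) => [|z [q [qn qp <-]]|z w [q [qn qp <-]] Ew].
- by exists p.
- have [f fE fq] := arc_extend qn.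
  have fshift m : fixator n (fun i => f (m + i)) = fixator n p.
    elim: m => [|m <-].
      rewrite -qp; apply/seteqP.
      by split=> x xf i le; have := xf i le; rewrite add0n fq.
    rewrite -(@fixator_shift (fun i => f (m + i))) => [|i _]; last by rewrite addnS.
    by congr (fixator n _); apply/funext => i; rewrite addnS.
  (* The segment of [f] from [n] to [2n], reversed by [r], ends at [r (f n)], that is at
     [r (q n)]. *)
  exists (fun i => r (f (n + (n - i))%N)); split.
  + move=> i lt; apply: rE.
    by rewrite subnS -[X in E _ (f (_ + X))]prednK ?subn_gt0 // addnS.
  + rewrite -(fshift n); apply/seteqP; split=> x xf i le.
      have := xf (n - i)%N (leq_subr _ _).
      by rewrite a_r subKn // => /(inv_inj rK).
    by rewrite a_r xf // leq_subr.
  + by rewrite subnn addn0 fq.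
- pose q' i := if i <= n then q i else w.
  have q'n : arc n.+1 q'.
    move=> i; rewrite ltnS leq_eqVlt /q' => /predU1P [->|lt]; first by rewrite leqnn ltnn.
    by rewrite lt (ltnW lt); apply: qn.
  exists (fun i => q' i.+1); split=> [i lt||]; first exact: q'n.
  + rewrite fixator_shift // -qp; apply/seteqP.
    by split=> x xq i le; have := xq i le; rewrite /q' le.
  + by rewrite /q' ltnn.
Qed.

End NotHighlyArcTransitive.

(** * Descendant sets and transitivity on arcs of every length *)

Let desc := fix desc n (v : V) : set V :=
  if n is m.+1 then [set w | exists2 u, E v u & desc m u w] else [set v].

Lemma desc_add m n v w : desc (m + n) v w <-> exists2 u, desc m v u & desc n u w.
Proof.
elim: m v => [|m IH] v /=; first by split=> [?|[u ->]] //; exists v.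
split=> [[u Eu /IH [x ux xw]]|[x [u Eu ux] xw]]; first by exists x => //; exists u.
by exists u => //; apply/IH; exists x.
Qed.

Lemma descS n v w : desc n.+1 v w <-> exists2 u, desc n v u & E u w.
Proof.
rewrite -addn1 desc_add; split=> [[u vu /= [x ux ->]]|[u vu uw]]; exists u => //=.
by exists w.
Qed.

Lemma desc_rev n v w : desc n v w -> desc n (r w) (r v).
Proof.
elim: n v => [|n IH] v /=; first by move->.
by move=> [u Eu /IH wu]; apply/descS; exists (r u) => //; apply: rE.
Qed.

Lemma desc_act g n v w : desc n v w -> desc n (a g v) (a g w).
Proof.
elim: n v => [|n IH] v /=; first by move->.
by move=> [u Eu /IH wu]; exists (a g u) => //; apply: aE.
Qed.

Lemma desc_act_image g n v : desc n (a g v) = a g @` desc n v.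
Proof.
apply/seteqP; split=> [w vw|_ [w vw <-]]; last exact: desc_act.
by exists (a g^-1 w); rewrite ?actVK // -(actK g v); apply: desc_act.
Qed.

Lemma desc_finite n v : finite_set (desc n v).
Proof.
elim: n v => [|n IH] v /=; first exact: finite_set1.
have [x [y xy]] := E2 v.
apply: (@sub_finite_set _ _ (desc n x `|` desc n y)); last by rewrite finite_setU.
by move=> w [u /xy [] -> uw]; [left | right].
Qed.

Lemma desc_arc n v w : desc n v w -> exists p, [/\ arc n p, p 0 = v & p n = w].
Proof.
elim: n v => [|n IH] v /=; first by move->; exists (fun=> v); split.
move=> [u Eu /IH [p [pn p0 <-]]]; exists (fun i => if i is j.+1 then p j else v).
by split=> // -[_|i /pn]; rewrite ?p0.
Qed.

Lemma desc_neq0 n v : exists w, desc n v w.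
Proof.
elim: n v => [|n IH] v; first by exists v.
by have [x [y xy]] := E2 v; have [w xw] := IH x; exists w, x => //; apply/xy; left.
Qed.

Lemma ncard_desc n v w : ncard (desc n v) = ncard (desc n w).
Proof.
have [g <-] := a_trans w v; rewrite desc_act_image ncard_image //.
  exact: desc_finite.
exact: act_inj.
Qed.

(** Let [g] move [v] to an out-neighbour. By transitivity on [n]-arcs each [n]-step descendant of
    [v] is [h g^n v = g^n (h ^ g^n) v] with [h] fixing [v], and [h ^ g^n] meets a bounded number of
    cosets of the stabilizer. *)
Lemma desc_bounded v : (forall n, arc_transitive n) ->
  exists K, forall n, ncard (desc n v) <= K.
Proof.
move=> tr; have [w [_ /(_ w) [_ /(_ (or_introl erefl)) Ew]]] := E2 v.
have [g gv] := a_trans v w.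
have [K KP] := uniscalar_bounded_index g uG (a_stab v).
exists K => n; have [s sK sP] := KP n; apply: leq_trans sK.
apply: (ncard_le_size (f := fun c => a (g ^+ n * c) v)) => z /desc_arc [q [qn q0 <-]].
have gn : arc n (fun i => a (g ^+ i) v).
  by move=> i _; rewrite expgSr aM gv; apply: aE.
have [h hq] := tr n _ _ gn qn.
have hv : a h v = v by have := hq 0 isT; rewrite expg0 a1 q0.
have [c cs /= cv] := sP h hv.
exists c => //; rewrite -hq // aM -{1}cv aM actVK act_conjg.
by rewrite actVK.
Qed.

Lemma highly_arc_transitive_compact_open_normal (v : V) :
  (forall n, arc_transitive n) ->
  exists U : set G, compact_open_subgroup U /\ normal_subgroup U.
Proof.
move=> tr; have [K KP] := desc_bounded v tr.
have desc_sub x y n : E x y -> desc n y `<=` desc n.+1 x by move=> Exy z yz; exists y.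
have [n|N NP] := @nondecreasing_bounded_stable (fun n => ncard (desc n v)) K _ KP.
  have [w [_ /(_ w) [_ /(_ (or_introl erefl)) Ew]]] := E2 v.
  rewrite (ncard_desc n v w); apply: ncard_sub; first exact: desc_finite.
  exact: desc_sub.
(* Beyond [N] the inclusion [desc_sub] is between finite sets of equal size. *)
have descE n x y : N <= n -> E x y -> desc n y = desc n.+1 x.
  move=> Nn Exy; apply: ncard_sub_eq; [exact: desc_finite | exact: desc_sub |].
  by rewrite (ncard_desc _ y v) (ncard_desc _ x v) !NP // leqW.
have descD k n x y : N <= n -> desc k x y -> desc n y = desc (k + n) x.
  move=> Nn; elim: k x => [|k IH] x /=; first by move->.
  move=> [u Eu /IH ->]; apply: descE => //.
  exact: leq_trans Nn (leq_addl _ _).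
pose H : set G := [set g | desc N (a g v) = desc N v].
have Hall g : H g -> forall w, desc N (a g w) = desc N w.
  move=> Hg; apply: (V_connected (v := v)) => // [x xg|x y xg Exy].
  (* Any [z] in the block of [x] determines the block of [r x]: it is the set of [2N]-step
     descendants of [r z]. The same [z] serves for [a g x]. *)
  - have [z xz] := desc_neq0 N x.
    have gxz : desc N (a g x) z by rewrite xg.
    rewrite a_r (descD N N _ _ (leqnn N) (desc_rev xz)).
    by rewrite (descD N N _ _ (leqnn N) (desc_rev gxz)).
  (* The block of [y] consists of the out-neighbours of the block of [x]. *)
  - rewrite (descE _ _ _ (leqnn N) Exy) (descE _ _ _ (leqnn N) (aE g Exy)).
    by apply/seteqP; split=> z /descS zP; apply/descS; move: zP; rewrite xg.
have sH : subgroup H.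
  split=> [|x y Hx Hy|x Hx]; rewrite /H /=.
  - by rewrite a1.
  - by rewrite aM !Hall.
  - by rewrite -(Hall x Hx) actVK.
have [z vz] := desc_neq0 N v.
exists H; split.
  have [s sP] : exists s : seq {classic V}, desc N v = [set` s].
    exact/finite_seqP/desc_finite.
  (* [H] moves [z] only within the finite block of [v], so finitely many cosets of the stabilizer of
     [z], one for each point of the block, cover [H]. *)
  have [c cP] := choice (a_trans z).
  apply: (compact_open_subgroup_commensurable (s := map c s) sH (a_stab z) (a_stab v)).
    by move=> g /= gv; rewrite /H /= gv.
  move=> h Hh; exists (c (a h z)).
    apply: (@map_f {classic V}).
    have : desc N v (a h z) by rewrite -(Hall h Hh); apply: desc_act.
    by rewrite sP.
  by rewrite /= aM -{2}(cP (a h z)) actK.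
apply: normal_subgroupP => // x g Hx.
by rewrite /H /= act_conjg desc_act_image Hall // -desc_act_image actK.
Qed.

Lemma reversible_digraph_compact_open_normal (v : V) :
  exists U : set G, compact_open_subgroup U /\ normal_subgroup U.
Proof.
have [tr|ntr] := pselect (forall n, arc_transitive n).
  exact: highly_arc_transitive_compact_open_normal v tr.
have [n trn ntrn] : exists2 n, arc_transitive n & ~ arc_transitive n.+1.
  apply: contrapT => nex; apply: ntr; elim=> [|n IH].
    move=> p q _ _; have [g gp] := a_trans (p 0) (q 0).
    by exists g => -[|].
  by apply: contrapT => nS; apply: nex; exists n.
have arc0 : arc 0 (fun=> v) by [].
have [p pE _] := arc_extend arc0.
have pn : arc n p by move=> i _.
apply: (@kernel_compact_open_normal (fixator n p)) => [|g gp w|g gv i _].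
- exact: fixator_compact_open.
- exact: fixator_fixes_all trn ntrn _ _ _ pn gp.
- exact: gv.
Qed.

End ReversibleDigraph.

(** * Cubic Cayley-Abels graphs *)

Section CubicGraphs.
Local Open Scope classical_set_scope.
Local Open Scope group_scope.

Lemma cubic_triple (X : sgraph) (v : X) : has_degree X 3 ->
  exists x y z, [/\ x <> y, x <> z, y <> z &
                    forall w, adj v w <-> [\/ w = x, w = y | w = z]].
Proof.
move=> /(_ v) /card_set_bijP [f [ff fI fS]].
have [x vx fx] := fS 0 isT.
have [y vy fy] := fS 1%N isT.
have [z vz fz] := fS 2 isT.
exists x, y, z; split=> [e|e|e|w].
- by move: fx; rewrite e fy.
- by move: fx; rewrite e fz.
- by move: fy; rewrite e fz.
split=> [vw|[] -> //].
have wI u : adj v u -> f w = f u -> w = u by move=> vu; apply: fI; rewrite inE.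
have := ff w vw; rewrite /=; case fw : (f w) => [|[|[|//]]] _.
- by constructor 1; apply: wI; rewrite ?fw ?fx.
- by constructor 2; apply: wI; rewrite ?fw ?fy.
- by constructor 3; apply: wI; rewrite ?fw ?fz.
Qed.

Lemma cubic_neighbours (X : sgraph) (v u : X) : has_degree X 3 -> adj v u ->
  exists x y, [/\ x <> y, x <> u, y <> u &
                  forall w, adj v w <-> [\/ w = u, w = x | w = y]].
Proof.
move=> /(cubic_triple v) [x [y [z [xy xz yz vE]]]] /vE.
case=> ->; [exists y, z | exists x, z | exists x, y].
all: split=> //; try by apply: nesym.
all: move=> w; rewrite vE; split; case=> ->.
all: by [constructor 1 | constructor 2 | constructor 3].
Qed.

Variables (G : topologicalGroupType) (X : sgraph) (a : graph_action G X).
Hypothesis X_connected : connected_graph X.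
Hypothesis X3 : has_degree X 3.
Hypothesis a_trans : vertex_transitive a.
Hypothesis a_stab : forall v, compact_open_subgroup (stabilizer a v).
Hypothesis uG : uniscalar G.

Let gK := actK (act1 a) (actM a).
Let gVK := actVK (act1 a) (actM a).
Let gI := act_inj (act1 a) (actM a).

Lemma connected_ind (v : X) (P : X -> Prop) : P v ->
  (forall x y, P x -> adj x y -> P y) -> forall w, P w.
Proof.
move=> Pv PE w; have [_ /(_ v w) [p + <-]] := X_connected.
elim: p v Pv => //= y p IH v Pv /andP [vy yp].
exact: IH (PE _ _ Pv vy) yp.
Qed.

(** The digraph has the arcs of [X] as vertices; [E] continues an arc without backtracking and [r]
    reverses it. Local transitivity makes [G] transitive on arcs. *)
Lemma locally_transitive_compact_open_normal (v : X) :
    (forall v w w', adj v w -> adj v w' -> exists2 g, a g v = v & a g w = w') ->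
  exists U : set G, compact_open_subgroup U /\ normal_subgroup U.
Proof.
move=> ltr.
pose A := {p : X * X | adj p.1 p.2}.
have AP (p : A) : adj (val p).1 (val p).2 by exact: (valP p).
pose mkA x y (xy : adj x y) : A := exist (fun p : X * X => adj p.1 p.2) (x, y) xy.
have actP g (p : A) : adj (a g (val p).1) (a g (val p).2) by rewrite act_adj.
pose b g (p : A) : A := mkA _ _ (actP g p).
have revP (p : A) : adj (val p).2 (val p).1 by rewrite adj_sym.
pose r (p : A) : A := mkA _ _ (revP p).
pose E (p q : A) := (val q).1 = (val p).2 /\ (val q).2 <> (val p).1.
have AI (p q : A) : (val p).1 = (val q).1 -> (val p).2 = (val q).2 -> p = q.
  move=> e1 e2; apply: val_inj.
  by rewrite (surjective_pairing (val p)) e1 e2 -surjective_pairing.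
have [x [_ [_ [_ _ _ /(_ x) [_ /(_ (Or31 _ _ erefl)) vx]]]]] := cubic_triple v X3.
have E_connected (p : A) (P : A -> Prop) : P p ->
    (forall q, P q -> P (r q)) -> (forall q q', P q -> E q q' -> P q') -> forall q, P q.
  move=> Pp Pr PE q.
  pose Q w := forall q : A, (val q).1 = w -> P q.
  suff : Q (val q).1 by apply.
  (* An arc starting at the end of [q1] is either the reverse of [q1] or one of its successors. *)
  have step q1 : P q1 -> Q (val q1).2.
    move=> Pq1 q2 q21; have [e|ne] := pselect ((val q2).2 = (val q1).1).
      by rewrite (_ : q2 = r q1); [apply: Pr | apply: AI].
    exact: PE Pq1 (conj q21 ne).
  apply: (@connected_ind (val p).2); first exact: step.
  move=> y z Qy yz; exact: (step (mkA _ _ yz) (Qy (mkA _ _ yz) erefl)).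
apply: (@reversible_digraph_compact_open_normal
  G A b _ _ _ _ uG E r _ _ _ _ _ E_connected).
- by move=> p; apply: AI; rewrite /= act1.
- by move=> g h p; apply: AI; rewrite /= actM.
- move=> p q; have [g gp] := a_trans (val p).1 (val q).1.
  have gpq : adj (val q).1 (a g (val p).2) by rewrite -gp act_adj; apply: AP.
  have [h hq hp] := ltr _ _ _ gpq (AP q).
  by exists (h * g); apply: AI; rewrite /= actM ?gp.
- move=> p; rewrite (_ : mkset _ = stabilizer a (val p).1 `&` stabilizer a (val p).2).
    exact: compact_open_subgroupI.
  apply/seteqP; split=> [g /= gp|g [g1 g2]]; last exact: AI.
  by split; rewrite /stabilizer /= -[in RHS]gp.
- by move=> p; apply: AI.
- by move=> g p; apply: AI.
- by move=> g p q [e ne]; split=> /= [|/gI //]; rewrite e.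
- by move=> p q [e ne]; split=> /=; [|apply: nesym].
- move=> p; have [y [z [yz yp zp pE]]] := cubic_neighbours X3 (revP p).
  have py : adj (val p).2 y by apply/pE; constructor 2.
  have pz : adj (val p).2 z by apply/pE; constructor 3.
  exists (mkA _ _ py), (mkA _ _ pz) => q; split.
    move=> [e ne]; have : adj (val p).2 (val q).2 by rewrite -e; apply: AP.
    by move=> /pE [//|qy|qz]; [left | right]; apply: AI.
  by case=> ->; split.
- exact: (mkA _ _ vx).
Qed.

Lemma fixed_neighbour_compact_open_normal (r : X -> X) (v : X) :
    (forall v, adj v (r v)) ->
    (forall v g, a g v = v -> a g (r v) = r v) ->
    (forall v w, adj v w -> (forall g, a g v = v -> a g w = w) -> w = r v) ->
  exists U : set G, compact_open_subgroup U /\ normal_subgroup U.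
Proof.
move=> vr r_fix r_uniq.
have rK : involutive r.
  move=> w; apply/esym/r_uniq; first by rewrite adj_sym.
  (* The stabilizers of [w] and [r w] coincide, so [w] is a neighbour fixed by the stabilizer of
     [r w]. *)
  apply: (uniscalar_stab_eq (act1 a) (actM a) a_trans a_stab uG); exact: r_fix.
have a_r g w : a g (r w) = r (a g w).
  apply: r_uniq => [|h hgw]; first by rewrite act_adj.
  have : a (g^-1 * h * g) (r w) = r w by apply: r_fix; rewrite !actM hgw gK.
  by rewrite !actM => e; rewrite -{2}e gVK.
pose E x y := adj (r x) y /\ y <> x.
apply: (@reversible_digraph_compact_open_normal
  G X a (act1 a) (actM a) a_trans a_stab uG E r rK a_r _ _ _ _ v).
- by move=> g x y [xy ne]; split; [rewrite -a_r act_adj | move=> /gI].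
- move=> x y [xy ne]; split; first by rewrite rK adj_sym.
  by move=> /(inv_inj rK) /nesym.
- move=> x; have rx : adj (r x) x by rewrite adj_sym.
  have [y [z [yz yx zx xE]]] := cubic_neighbours X3 rx.
  exists y, z => w; rewrite /E xE; split=> [[[]]|[] ->]; try by tauto.
  + by split=> //; constructor 2.
  + by split=> //; constructor 3.
- move=> x P Px Pr PE; apply: connected_ind Px _ => y z Py yz.
  have [->|ne] := pselect (z = r y); first exact: Pr.
  by apply: (PE (r y)); [apply: Pr | split; rewrite ?rK].
Qed.

(** The vertices [w] and [w'] lie in different orbits on three neighbours. If [w] can be moved to
    the third, then [w'] is alone in its orbit; otherwise [w] is. *)
Lemma locally_intransitive_fixed_neighbour (v w w' : X) :
    adj v w -> adj v w' -> (forall g, a g v = v -> a g w <> w') ->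
  exists2 u, adj v u & forall g, a g v = v -> a g u = u.
Proof.
move=> vw vw' ntr.
have ww' : w <> w' by move=> e; apply: (ntr 1); rewrite ?act1.
have stabV g : a g v = v -> a g^-1 v = v by move=> gv; rewrite -{1}gv gK.
have [z vE] : exists z, forall u, adj v u -> [\/ u = w, u = w' | u = z].
  have [x [y [xy xw yw vE]]] := cubic_neighbours X3 vw.
  move/vE: vw' => [e|e|e]; first by case: ww'.
    by exists y => u /vE; rewrite e.
  by exists x => u /vE; rewrite e => -[] ->; constructor.
have adjg g u : a g v = v -> adj v u -> adj v (a g u).
  by move=> gv vu; rewrite -gv act_adj.
have [[h hv hw]|nz] := pselect (exists2 h, a h v = v & a h w = z); last first.
  exists w => // g gv; have [//|/ntr|e] := vE _ (adjg _ _ gv vw); first by case/(_ gv).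
  by case: nz; exists g.
exists w' => // g gv; have [e|//|e] := vE _ (adjg _ _ gv vw').
  by case: (ntr g^-1); [apply: stabV | rewrite -e gK].
case: (ntr (g^-1 * h)); rewrite actM ?hv; first exact: stabV.
by rewrite hw -e gK.
Qed.

Lemma cubic_compact_open_normal :
  exists U : set G, compact_open_subgroup U /\ normal_subgroup U.
Proof.
have [[v] _] := X_connected.
have [ltr|] := pselect (forall v w w', adj v w -> adj v w' ->
    exists2 g, a g v = v & a g w = w').
  exact: locally_transitive_compact_open_normal v ltr.
move=> nltr.
have [u [w [w' [uw uw' ntr]]]] : exists u w w',
    [/\ adj u w, adj u w' & forall g, a g u = u -> a g w <> w'].
  apply: contrapT => nex; apply: nltr => u w w' uw uw'.
  apply: contrapT => ng; apply: nex; exists u, w, w'; split=> // g gu gw.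
  by apply: ng; exists g.
have [y uy uyfix] := locally_intransitive_fixed_neighbour uw uw' ntr.
have rex x : exists y, adj x y /\ forall g, a g x = x -> a g y = y.
  have [g gx] := a_trans u x; exists (a g y); split; first by rewrite -gx act_adj.
  move=> h hx; have := uyfix (g^-1 * h * g); rewrite !actM gx hx -gx gK => /(_ erefl) e.
  by rewrite -{2}e gVK.
have [r rP] := choice rex.
have [r_uniq|] := pselect (forall v w, adj v w ->
    (forall g, a g v = v -> a g w = w) -> w = r v).
  apply: (fixed_neighbour_compact_open_normal v _ _ r_uniq) => x; by have [] := rP x.
move=> nuniq.
(* A vertex with a fixed neighbour [z] other than [r x] has two of its three neighbours fixed, hence
   also the third. *)
have [x xfix] : exists x, forall y g, adj x y -> a g x = x -> a g y = y.
  apply: contrapT => nex; apply: nuniq => x z xz zfix.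
  apply: contrapT => zr; apply: nex; exists x => t g xt gx.
  have [xr rfix] := rP x.
  have [s [s' [ss' sr s'r xE]]] := cubic_neighbours X3 xr.
  have third q q' : (forall t, adj x t <-> [\/ t = r x, t = q | t = q']) ->
      z = q -> q' <> r x -> q <> q' -> a g t = t.
    move=> qE zq q'r qq'; move/qE: (xt) => [->|->|tq']; first exact: rfix.
      by rewrite -zq; apply: zfix.
    have : adj x (a g t) by rewrite -gx act_adj.
    move=> /qE [e|e|->//].
      by case: q'r; rewrite -tq'; apply: (@gI g); rewrite e rfix.
    by case: qq'; rewrite -tq' -zq; apply/esym/(@gI g); rewrite e zfix.
  move/xE: (xz) => [//|zs|zs']; first exact: (third s s').
  apply: (third s' s) => // [t'|]; last exact: nesym.
  by rewrite xE; split; case=> ->; by [constructor 1 | constructor 2 | constructor 3].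
have allfix y0 z g : adj y0 z -> a g y0 = y0 -> a g z = z.
  have [h hx] := a_trans x y0; move=> yz gy.
  have := xfix (a h^-1 z) (g ^ h); rewrite !(act_conjg (actM a)) gVK => e.
  apply: (@gI h^-1); apply: e; last by rewrite hx gy -hx gK.
  by rewrite -(act_adj a h) gVK hx.
apply: (@kernel_compact_open_normal G X a (act1 a) (actM a) (stabilizer a x)).
- exact: a_stab.
- by move=> g gx; apply: (connected_ind (v := x)) => // t z gt tz; apply: allfix tz gt.
- by move=> g; apply.
Qed.

End CubicGraphs.

(** A positive value cannot be the default 0, so it is attained; with [mv G = 3] this supplies a
    cubic Cayley-Abels graph. *)
Lemma natmin_positive_mem (A : set nat) n : natmin A = n.+1 -> A n.+1.
Proof. by rewrite /natmin; case: xgetP => // m -> [Am _] <-. Qed.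

Theorem theorem6p2 (G : topologicalGroupType) (hcg : compactly_generated G)
    (htdlc : tdlc G)
    (hnorm : ~ exists U : set G, compact_open_subgroup U /\ normal_subgroup U)
    (hmv : mv G = 3) :
  ~ uniscalar G.
Proof.
move=> uG; apply: hnorm.
have [X [X_conn _ [a [a_trans a_stab]]] X3] := natmin_positive_mem hmv.
exact: (cubic_compact_open_normal X_conn X3 a_trans a_stab uG).
Qed.
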